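(* Let $\underline R$ be any EEC computation type and let $(\cdot)^\bullet$, $(\cdot)^\circ$ be the generic linear-use CPS self-translation of EEC relative to $\underline R$. Then: (1) If $\Gamma\mid-\vdash t=u:A$, then $\Gamma^\bullet\mid-\vdash t^\bullet=u^\bullet:A^\bullet$. (2) If $\Gamma\mid z{:}\underline A\vdash t=u:\underline B$, then $\Gamma^\bullet\mid k_z{:}\underline B^\circ\vdash t^\circ=u^\circ:\underline A^\circ$.
   Context: **EEC (enriched effect calculus).** There are value-type constants $\alpha,\beta,\ldots$ and a disjoint set of computation-type constants $\underline{\alpha},\underline{\beta},\ldots$. Value types $A,B,C$ and computation types $\underline{A},\underline{B},\underline{C},\underline{D}$ are generated by $A::=\alpha\mid 1\mid A\times B\mid A\to B\mid \underline{A}\mid \underline{A}\multimap\underline{B}$ and $\underline{A}::=\underline{\alpha}\mid\underline{1}\mid\underline{A}\,\&\,\underline{B}\mid A\Rightarrow\underline{B}\mid\underline{I}\mid\ !A\mid\ !A\otimes\underline{B}\mid\underline{0}\mid\underline{A}\oplus\underline{B}$ (every computation type is also a value type; $!A\otimes\underline{B}$ is one primitive binary constructor). Judgements are $\Gamma\mid -\vdash t:A$ and $\Gamma\mid z{:}\underline{A}\vdash t:\underline{B}$, where $\Gamma$ lists distinct variables with value types and the ''stoup'' holds at most one variable, of computation type; with nonempty stoup the result type is a computation type. Below $\Delta$ is empty or $z{:}\underline{D}$. Typing rules: $\Gamma,x{:}A\mid-\vdash x:A$; $\Gamma\mid-\vdash *:1$; pairs $\langle t,u\rangle:A\times B$,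 projections $\pi_1t,\pi_2t$; $\lambda x{:}A.t:A\to B$ from $\Gamma,x{:}A\mid-\vdash t:B$; application $t\,u$ (all with empty stoup). $\Gamma\mid z{:}\underline A\vdash z:\underline A$; $\Gamma\mid\Delta\vdash\underline{*}:\underline 1$; from $\Gamma\mid\Delta\vdash t:\underline A$, $\Gamma\mid\Delta\vdash u:\underline B$ get $\Gamma\mid\Delta\vdash\langle t,u\rangle_c:\underline A\,\&\,\underline B$, and from $\Gamma\mid\Delta\vdash t:\underline A\,\&\,\underline B$ get $\underline\pi_1t:\underline A$, $\underline\pi_2t:\underline B$; from $\Gamma,x{:}A\mid\Delta\vdash t:\underline B$ get $\Gamma\mid\Delta\vdash\underline\lambda x{:}A.t:A\Rightarrow\underline B$; from $\Gamma\mid\Delta\vdash s:A\Rightarrow\underline B$, $\Gamma\mid-\vdash t:A$ get $\Gamma\mid\Delta\vdash s@t:\underline B$; $\Gamma\mid-\vdash\top:\underline I$; from $\Gamma\mid\Delta\vdash t:\underline I$, $\Gamma\mid-\vdash u:\underline A$ get $\Gamma\mid\Delta\vdash \mathrm{let}\ \top\ \mathrm{be}\ t\ \mathrm{in}\ u:\underline A$; from $\Gamma\mid-\vdash t:A$ get $\Gamma\mid-\vdash\,!t:\,!A$; from $\Gamma\mid\Delta\vdash t:\,!A$, $\Gamma,x{:}A\mid-\vdash u:\underline B$ get $\Gamma\mid\Delta\vdash\mathrm{let}\ !x\ \mathrm{be}\ t\ \mathrm{in}\ u:\underline B$; from $\Gamma\mid-\vdash t:A$, $\Gamma\mid\Delta\vdash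 u:\underline B$ get $\Gamma\mid\Delta\vdash\,!t\otimes u:\,!A\otimes\underline B$; from $\Gamma\mid\Delta\vdash s:\,!A\otimes\underline B$, $\Gamma,x{:}A\mid y{:}\underline B\vdash t:\underline C$ get $\Gamma\mid\Delta\vdash\mathrm{let}\ !x\otimes y\ \mathrm{be}\ s\ \mathrm{in}\ t:\underline C$; from $\Gamma\mid\Delta\vdash t:\underline 0$ get $\Gamma\mid\Delta\vdash\mathrm{abort}_{\underline A}(t):\underline A$; $\mathrm{inl}\,t:\underline A\oplus\underline B$ from $t:\underline A$ and $\mathrm{inr}\,t$ from $t:\underline B$ (same $\Gamma\mid\Delta$); from $\Gamma\mid\Delta\vdash s:\underline A\oplus\underline B$, $\Gamma\mid x{:}\underline A\vdash t:\underline C$, $\Gamma\mid y{:}\underline B\vdash u:\underline C$ get $\Gamma\mid\Delta\vdash\mathrm{case}\ s\ \mathrm{of}\ (\mathrm{inl}\,x\Rightarrow t\mid\mathrm{inr}\,y\Rightarrow u):\underline C$; from $\Gamma\mid z{:}\underline A\vdash t:\underline B$ get $\Gamma\mid-\vdash\hat\lambda z{:}\underline A.t:\underline A\multimap\underline B$; from $\Gamma\mid-\vdash s:\underline A\multimap\underline B$, $\Gamma\mid\Delta\vdash t:\underline A$ get $\Gamma\mid\Delta\vdash s\{t\}:\underline B$. Equality $\Gamma\mid\Delta\vdash t=u:A$ is the least typed congruence (equivalence, compatible with all term formers, containing $\alpha$-equivalence) containing all well-typed instances of: $t=*$ for $t:1$; $\pi_1\langle t,u\rangle=t$, $\pi_2\langle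 t,u\rangle=u$, $\langle\pi_1t,\pi_2t\rangle=t$; $(\lambda x.t)u=t[u/x]$, $\lambda x.(t\,x)=t$ ($x$ not free in $t$); $t=\underline*$ for $t:\underline1$; $\underline\pi_1\langle t,u\rangle_c=t$, $\underline\pi_2\langle t,u\rangle_c=u$, $\langle\underline\pi_1t,\underline\pi_2t\rangle_c=t$; $(\underline\lambda x.t)@u=t[u/x]$, $\underline\lambda x.(t@x)=t$ ($x$ not free); $\mathrm{let}\ \top\ \mathrm{be}\ \top\ \mathrm{in}\ t=t$; $\mathrm{let}\ \top\ \mathrm{be}\ t\ \mathrm{in}\ u[\top/x]=u[t/x]$ for $\Gamma\mid x{:}\underline I\vdash u:\underline A$; $\mathrm{let}\ !x\ \mathrm{be}\ !t\ \mathrm{in}\ u=u[t/x]$; $\mathrm{let}\ !x\ \mathrm{be}\ t\ \mathrm{in}\ u[!x/y]=u[t/y]$ for $\Gamma\mid y{:}\,!A\vdash u:\underline B$; $\mathrm{let}\ !x\otimes y\ \mathrm{be}\ !t\otimes s\ \mathrm{in}\ u=u[t/x,s/y]$; $\mathrm{let}\ !x\otimes y\ \mathrm{be}\ t\ \mathrm{in}\ u[(!x\otimes y)/z]=u[t/z]$ for $\Gamma\mid z{:}\,!A\otimes\underline B\vdash u:\underline C$; $\mathrm{abort}_{\underline A}(t)=u[t/x]$ for $\Gamma\mid x{:}\underline 0\vdash u:\underline A$; $\mathrm{case}\ \mathrm{inl}\,t\ \mathrm{of}\ (\mathrm{inl}\,x\Rightarrow u\mid\mathrm{inr}\,y\Rightarrow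 u')=u[t/x]$ and symmetrically for $\mathrm{inr}$; $\mathrm{case}\ t\ \mathrm{of}\ (\mathrm{inl}\,x\Rightarrow u[\mathrm{inl}\,x/z]\mid\mathrm{inr}\,y\Rightarrow u[\mathrm{inr}\,y/z])=u[t/z]$ for $\Gamma\mid z{:}\underline A\oplus\underline B\vdash u:\underline C$; $(\hat\lambda x.t)\{u\}=t[u/x]$, $\hat\lambda x.(t\{x\})=t$ ($x$ not free). **Generic self-translation relative to a computation type $\underline R$.** Types: $\alpha^\bullet=\alpha$, $1^\bullet=1$, $(A\times B)^\bullet=A^\bullet\times B^\bullet$, $(A\to B)^\bullet=A^\bullet\to B^\bullet$, $\underline A^\bullet=\underline A^\circ\multimap\underline R$ (a computation type viewed as a value type), $(\underline A\multimap\underline B)^\bullet=\underline B^\circ\multimap\underline A^\circ$; $\underline\alpha^\circ=\underline\alpha$ if $\underline\alpha\neq\underline R$ and $\underline\alpha^\circ=\underline I$ if $\underline R$ is the constant $\underline\alpha$; $\underline1^\circ=\underline0$; $(\underline A\,\&\,\underline B)^\circ=\underline A^\circ\oplus\underline B^\circ$; $(A\Rightarrow\underline B)^\circ=\,!(A^\bullet)\otimes\underline B^\circ$; $\underline I^\circ=\underline R$; $(!A)^\circ=A^\bullet\Rightarrow\underline R$; $(!A\otimes\underline B)^\circ=A^\bullet\Rightarrow\underline B^\circ$; $\underline0^\circ=\underline1$; $(\underline A\oplus\underline B)^\circ=\underline A^\circ\,\&\,\underline B^\circ$. For $\Gamma=x_1{:}C_1,\ldots,x_n{:}C_n$, $\Gamma^\bullet=x_1{:}C_1^\bullet,\ldots,x_n{:}C_n^\bullet$.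 To each variable $z$ is associated a distinct fresh variable $k_z$ (so iterating gives $k_{k_z}$); $k,h,k_x,k_y$ below are fresh bound variables. Terms: a judgement $\Gamma\mid-\vdash t:A$ goes to $\Gamma^\bullet\mid-\vdash t^\bullet:A^\bullet$, and $\Gamma\mid z{:}\underline D\vdash t:\underline B$ goes to $\Gamma^\bullet\mid k_z{:}\underline B^\circ\vdash t^\circ:\underline D^\circ$ (contravariantly); type names below refer to the typing rules. Value clauses: $x^\bullet=x$; $*^\bullet=*$; $\langle t,u\rangle^\bullet=\langle t^\bullet,u^\bullet\rangle$; $(\pi_it)^\bullet=\pi_it^\bullet$; $(\lambda x{:}A.t)^\bullet=\lambda x{:}A^\bullet.t^\bullet$; $(t\,u)^\bullet=t^\bullet\,u^\bullet$; $\underline*^\bullet=\hat\lambda k{:}\underline0.\,\mathrm{abort}_{\underline R}(k)$; $\langle t,u\rangle_c^\bullet=\hat\lambda k{:}\underline A^\circ\oplus\underline B^\circ.\,\mathrm{case}\ k\ \mathrm{of}\ (\mathrm{inl}\,k_x\Rightarrow t^\bullet\{k_x\}\mid\mathrm{inr}\,k_y\Rightarrow u^\bullet\{k_y\})$; $(\underline\pi_1t)^\bullet=\hat\lambda k{:}\underline A^\circ.\,t^\bullet\{\mathrm{inl}\,k\}$; $(\underline\pi_2t)^\bullet=\hat\lambda k{:}\underline B^\circ.\,t^\bullet\{\mathrm{inr}\,k\}$; $(\underline\lambda x{:}A.t)^\bullet=\hat\lambda k{:}\,!A^\bullet\otimes\underline B^\circ.\,\mathrm{let}\ !x\otimes h\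 \mathrm{be}\ k\ \mathrm{in}\ t^\bullet\{h\}$; $(s@t)^\bullet=\hat\lambda k{:}\underline B^\circ.\,s^\bullet\{!(t^\bullet)\otimes k\}$; $\top^\bullet=\hat\lambda k{:}\underline R.\,k$; $(\mathrm{let}\ \top\ \mathrm{be}\ t\ \mathrm{in}\ u)^\bullet=\hat\lambda k{:}\underline A^\circ.\,t^\bullet\{u^\bullet\{k\}\}$; $(!t)^\bullet=\hat\lambda k{:}A^\bullet\Rightarrow\underline R.\,k@t^\bullet$; $(\mathrm{let}\ !x\ \mathrm{be}\ t\ \mathrm{in}\ u)^\bullet=\hat\lambda k{:}\underline B^\circ.\,t^\bullet\{\underline\lambda x{:}A^\bullet.\,u^\bullet\{k\}\}$; $(!t\otimes u)^\bullet=\hat\lambda k{:}A^\bullet\Rightarrow\underline B^\circ.\,u^\bullet\{k@t^\bullet\}$; $(\mathrm{let}\ !x\otimes y\ \mathrm{be}\ s\ \mathrm{in}\ t)^\bullet=\hat\lambda k{:}\underline C^\circ.\,s^\bullet\{\underline\lambda x{:}A^\bullet.\,t^\circ[k/k_y]\}$; $(\mathrm{abort}_{\underline A}(t))^\bullet=\hat\lambda k{:}\underline A^\circ.\,t^\bullet\{\underline*\}$; $(\mathrm{inl}\,t)^\bullet=\hat\lambda k{:}\underline A^\circ\,\&\,\underline B^\circ.\,t^\bullet\{\underline\pi_1k\}$; $(\mathrm{inr}\,t)^\bullet=\hat\lambda k{:}\underline A^\circ\,\&\,\underline B^\circ.\,t^\bullet\{\underline\pi_2k\}$; $(\mathrm{case}\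 s\ \mathrm{of}\ (\mathrm{inl}\,x\Rightarrow t\mid\mathrm{inr}\,y\Rightarrow u))^\bullet=\hat\lambda k{:}\underline C^\circ.\,s^\bullet\{\langle t^\circ[k/k_x],u^\circ[k/k_y]\rangle_c\}$; $(\hat\lambda z{:}\underline A.t)^\bullet=\hat\lambda k{:}\underline B^\circ.\,t^\circ[k/k_z]$; $(s\{t\})^\bullet=\hat\lambda k{:}\underline B^\circ.\,t^\bullet\{s^\bullet\{k\}\}$. Computation clauses (stoup $z{:}\underline D$): $z^\circ=k_z$; $\underline*^\circ=\mathrm{abort}_{\underline D^\circ}(k_z)$; $\langle t,u\rangle_c^\circ=\mathrm{case}\ k_z\ \mathrm{of}\ (\mathrm{inl}\,k_x\Rightarrow t^\circ[k_x/k_z]\mid\mathrm{inr}\,k_y\Rightarrow u^\circ[k_y/k_z])$; $(\underline\pi_1t)^\circ=t^\circ[\mathrm{inl}\,k_z/k_z]$; $(\underline\pi_2t)^\circ=t^\circ[\mathrm{inr}\,k_z/k_z]$; $(\underline\lambda x{:}A.t)^\circ=\mathrm{let}\ !x\otimes h\ \mathrm{be}\ k_z\ \mathrm{in}\ t^\circ[h/k_z]$; $(s@t)^\circ=s^\circ[(!(t^\bullet)\otimes k_z)/k_z]$; $(\mathrm{let}\ \top\ \mathrm{be}\ t\ \mathrm{in}\ u)^\circ=t^\circ[u^\bullet\{k_z\}/k_z]$; $(\mathrm{let}\ !x\ \mathrm{be}\ t\ \mathrm{in}\ u)^\circ=t^\circ[(\underline\lambda x{:}A^\bullet.\,u^\bullet\{k_z\})/k_z]$;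 $(!t\otimes u)^\circ=u^\circ[(k_z@t^\bullet)/k_z]$; $(\mathrm{let}\ !x\otimes y\ \mathrm{be}\ s\ \mathrm{in}\ t)^\circ=s^\circ[(\underline\lambda x{:}A^\bullet.\,t^\circ[k_z/k_y])/k_z]$; $(\mathrm{abort}(t))^\circ=t^\circ[\underline*/k_z]$; $(\mathrm{inl}\,t)^\circ=t^\circ[\underline\pi_1k_z/k_z]$; $(\mathrm{inr}\,t)^\circ=t^\circ[\underline\pi_2k_z/k_z]$; $(\mathrm{case}\ s\ \mathrm{of}\ (\mathrm{inl}\,x\Rightarrow t\mid\mathrm{inr}\,y\Rightarrow u))^\circ=s^\circ[\langle t^\circ[k_z/k_x],u^\circ[k_z/k_y]\rangle_c/k_z]$; $(s\{t\})^\circ=t^\circ[s^\bullet\{k_z\}/k_z]$. *)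

(* Defs.v *)
From mathcomp Require Import all_boot.

Set Implicit Arguments.
Unset Strict Implicit.
Unset Printing Implicit Defensive.

(* [V] and [C] are the sets of value-type and computation-type constants. *)
Inductive vty (V C : Type) : Type :=
  | vconst (a : V)                     (* alpha *)
  | vone                               (* 1 *)
  | vprod (A B : vty V C)              (* A x B *)
  | vfun (A B : vty V C)               (* A -> B *)
  | vcomp (A : cty V C)                (* a computation type as a value type *)
  | vlolli (A B : cty V C)             (* A -o B *)
with cty (V C : Type) : Type :=
  | cconst (a : C)                     (* underlined alpha *)
  | cone                               (* underlined 1 *)
  | cwith (A B : cty V C)              (* A & B *)
  | cpow (A : vty V C) (B : cty V C)   (* A => B *)
  | cunit                              (* I *)
  | cbang (A : vty V C)                (* !A *)
  | ctens (A : vty V C) (B : cty V C)  (* !A (x) B *)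
  | czero                              (* 0 *)
  | csum (A B : cty V C).              (* A (+) B *)

Arguments vone {V C}.
Arguments cone {V C}.
Arguments cunit {V C}.
Arguments czero {V C}.
Arguments vconst {V C} a.
Arguments cconst {V C} a.

Coercion vcomp : cty >-> vty.

(* Variables are de Bruijn indices: a context is the list of the types of its
   variables, most recent first, and a stoup is [None] or [Some] of the type
   of its only variable. *)
Definition ctx (V C : Type) := seq (vty V C).
Definition stoup (V C : Type) := option (cty V C).

Section Syntax.
Context {V C : Type}.
Local Notation vty := (vty V C).
Local Notation cty := (cty V C).
Local Notation ctx := (ctx V C).
Local Notation stoup := (stoup V C).

Inductive var : ctx -> vty -> Type :=
  | V0 G A : var (A :: G) A
  | VS G A B : var G A -> var (B :: G) A.

(* [tm G D A] is the type of derivations of G | D |- t : A.  Terms are thus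
   fully annotated and taken up to alpha-equivalence.  By inspection of the
   constructors, [tm G (Some E) A] is inhabited only if [A] is of the form
   [vcomp B]. *)
Inductive tm : ctx -> stoup -> vty -> Type :=
  | Var G A : var G A -> tm G None A
  | Star G : tm G None vone
  | Pair G A B : tm G None A -> tm G None B -> tm G None (vprod A B)
  | Fst G A B : tm G None (vprod A B) -> tm G None A
  | Snd G A B : tm G None (vprod A B) -> tm G None B
  | Lam G A B : tm (A :: G) None B -> tm G None (vfun A B)
  | App G A B : tm G None (vfun A B) -> tm G None A -> tm G None B
  | SVar G (A : cty) : tm G (Some A) A
  | CStar G D : tm G D cone
  | CPair G D (A B : cty) : tm G D A -> tm G D B -> tm G D (cwith A B)
  | CFst G D (A B : cty) : tm G D (cwith A B) -> tm G D A
  | CSnd G D (A B : cty) : tm G D (cwith A B) -> tm G D B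
  | CLam G D A (B : cty) : tm (A :: G) D B -> tm G D (cpow A B)
  | CApp G D A (B : cty) : tm G D (cpow A B) -> tm G None A -> tm G D B
  | Top G : tm G None cunit
  (* let T be t in u *)
  | LetTop G D (A : cty) : tm G D cunit -> tm G None A -> tm G D A
  | Bang G A : tm G None A -> tm G None (cbang A)
  (* let !x be t in u *)
  | LetBang G D A (B : cty) :
      tm G D (cbang A) -> tm (A :: G) None B -> tm G D B
  (* !t (x) u *)
  | Tens G D A (B : cty) : tm G None A -> tm G D B -> tm G D (ctens A B)
  (* let !x (x) y be s in t *)
  | LetTens G D A (B E : cty) :
      tm G D (ctens A B) -> tm (A :: G) (Some B) E -> tm G D E
  | Abort G D (A : cty) : tm G D czero -> tm G D A
  | Inl G D (A B : cty) : tm G D A -> tm G D (csum A B)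
  | Inr G D (A B : cty) : tm G D B -> tm G D (csum A B)
  | Case G D (A B E : cty) :
      tm G D (csum A B) -> tm G (Some A) E -> tm G (Some B) E -> tm G D E
  (* \hat\lambda z. t and s{t} *)
  | HLam G (A B : cty) : tm G (Some A) B -> tm G None (vlolli A B)
  | HApp G D (A B : cty) : tm G None (vlolli A B) -> tm G D A -> tm G D B.

Definition var_case (P : vty -> Type) G B (p0 : P B)
    (pS : forall A, var G A -> P A) A (x : var (B :: G) A) : P A :=
  match x in var G' A' return
    match G' with
    | [::] => unit
    | B' :: G'' => P B' -> (forall A, var G'' A -> P A) -> P A'
    end
  with
  | V0 _ _ => fun q0 _ => q0
  | VS _ _ _ y => fun _ qS => qS _ y
  end p0 pS.

Definition renaming G G' := forall A, var G A -> var G' A.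

Definition lift_ren G G' B (r : renaming G G') :
    renaming (B :: G) (B :: G') :=
  @var_case (var (B :: G')) G B (V0 G' B) (fun A y => VS B (r A y)).

Fixpoint rename G D A (t : tm G D A) : forall G', renaming G G' -> tm G' D A :=
  match t in tm G D A return forall G', renaming G G' -> tm G' D A with
  | Var _ _ x => fun _ r => Var (r _ x)
  | Star _ => fun _ _ => Star _
  | Pair _ _ _ t u => fun _ r => Pair (rename t r) (rename u r)
  | Fst _ _ _ t => fun _ r => Fst (rename t r)
  | Snd _ _ _ t => fun _ r => Snd (rename t r)
  | Lam _ _ _ t => fun _ r => Lam (rename t (lift_ren r))
  | App _ _ _ t u => fun _ r => App (rename t r) (rename u r)
  | SVar _ A => fun _ _ => SVar _ A
  | CStar _ D => fun _ _ => CStar _ D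
  | CPair _ _ _ _ t u => fun _ r => CPair (rename t r) (rename u r)
  | CFst _ _ _ _ t => fun _ r => CFst (rename t r)
  | CSnd _ _ _ _ t => fun _ r => CSnd (rename t r)
  | CLam _ _ _ _ t => fun _ r => CLam (rename t (lift_ren r))
  | CApp _ _ _ _ s t => fun _ r => CApp (rename s r) (rename t r)
  | Top _ => fun _ _ => Top _
  | LetTop _ _ _ t u => fun _ r => LetTop (rename t r) (rename u r)
  | Bang _ _ t => fun _ r => Bang (rename t r)
  | LetBang _ _ _ _ t u =>
      fun _ r => LetBang (rename t r) (rename u (lift_ren r))
  | Tens _ _ _ _ t u => fun _ r => Tens (rename t r) (rename u r)
  | LetTens _ _ _ _ _ s t =>
      fun _ r => LetTens (rename s r) (rename t (lift_ren r))
  | Abort _ _ A t => fun _ r => Abort A (rename t r)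
  | Inl _ _ _ B t => fun _ r => Inl B (rename t r)
  | Inr _ _ A _ t => fun _ r => Inr A (rename t r)
  | Case _ _ _ _ _ s t u =>
      fun _ r => Case (rename s r) (rename t r) (rename u r)
  | HLam _ _ _ t => fun _ r => HLam (rename t r)
  | HApp _ _ _ _ s t => fun _ r => HApp (rename s r) (rename t r)
  end.

Definition weaken G D A B (t : tm G D A) : tm (B :: G) D A :=
  rename t (fun A' x => VS B x).

Definition substitution G G' := forall A, var G A -> tm G' None A.

Definition lift_sub G G' B (s : substitution G G') :
    substitution (B :: G) (B :: G') :=
  @var_case (tm (B :: G') None) G B (Var (V0 G' B))
    (fun A y => weaken B (s A y)).

Fixpoint subst G D A (t : tm G D A) :
    forall G', substitution G G' -> tm G' D A :=
  match t in tm G D A return forall G', substitution G G' -> tm G' D A with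
  | Var _ _ x => fun _ r => r _ x
  | Star _ => fun _ _ => Star _
  | Pair _ _ _ t u => fun _ r => Pair (subst t r) (subst u r)
  | Fst _ _ _ t => fun _ r => Fst (subst t r)
  | Snd _ _ _ t => fun _ r => Snd (subst t r)
  | Lam _ _ _ t => fun _ r => Lam (subst t (lift_sub r))
  | App _ _ _ t u => fun _ r => App (subst t r) (subst u r)
  | SVar _ A => fun _ _ => SVar _ A
  | CStar _ D => fun _ _ => CStar _ D
  | CPair _ _ _ _ t u => fun _ r => CPair (subst t r) (subst u r)
  | CFst _ _ _ _ t => fun _ r => CFst (subst t r)
  | CSnd _ _ _ _ t => fun _ r => CSnd (subst t r)
  | CLam _ _ _ _ t => fun _ r => CLam (subst t (lift_sub r))
  | CApp _ _ _ _ s t => fun _ r => CApp (subst s r) (subst t r)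
  | Top _ => fun _ _ => Top _
  | LetTop _ _ _ t u => fun _ r => LetTop (subst t r) (subst u r)
  | Bang _ _ t => fun _ r => Bang (subst t r)
  | LetBang _ _ _ _ t u =>
      fun _ r => LetBang (subst t r) (subst u (lift_sub r))
  | Tens _ _ _ _ t u => fun _ r => Tens (subst t r) (subst u r)
  | LetTens _ _ _ _ _ s t =>
      fun _ r => LetTens (subst s r) (subst t (lift_sub r))
  | Abort _ _ A t => fun _ r => Abort A (subst t r)
  | Inl _ _ _ B t => fun _ r => Inl B (subst t r)
  | Inr _ _ A _ t => fun _ r => Inr A (subst t r)
  | Case _ _ _ _ _ s t u =>
      fun _ r => Case (subst s r) (subst t r) (subst u r)
  | HLam _ _ _ t => fun _ r => HLam (subst t r)
  | HApp _ _ _ _ s t => fun _ r => HApp (subst s r) (subst t r)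
  end.

(* u[t/x] for the most recent context variable x. *)
Definition vsubst G D A B (u : tm (A :: G) D B) (t : tm G None A) :
    tm G D B :=
  subst u (@var_case (tm G None) G A t (fun A' y => Var y)).

(* Substitution for the stoup variable.  It is defined by recursion on terms
   with an arbitrary stoup [D]: a term with an empty stoup has nothing to
   substitute for and is left unchanged, whence [plugged] and [plug]. *)
Definition plugged (D D' : stoup) : stoup := if D is Some _ then D' else None.

Definition plug G (D D' : stoup) : Type :=
  if D is Some E then tm G D' (vcomp E) else unit.

Definition weaken_plug G D D' B : plug G D D' -> plug (B :: G) D D' :=
  match D return plug G D D' -> plug (B :: G) D D' with
  | Some _ => fun s => weaken B s
  | None => fun _ => tt
  end.

Fixpoint splug G D A (t : tm G D A) :
    forall D', plug G D D' -> tm G (plugged D D') A :=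
  match t in tm G D A return
    forall D', plug G D D' -> tm G (plugged D D') A
  with
  | Var _ _ x => fun _ _ => Var x
  | Star _ => fun _ _ => Star _
  | Pair _ _ _ t u => fun _ _ => Pair t u
  | Fst _ _ _ t => fun _ _ => Fst t
  | Snd _ _ _ t => fun _ _ => Snd t
  | Lam _ _ _ t => fun _ _ => Lam t
  | App _ _ _ t u => fun _ _ => App t u
  | SVar _ _ => fun _ p => p
  | CStar _ _ => fun _ _ => CStar _ _
  | CPair _ _ _ _ t u => fun _ p => CPair (splug t p) (splug u p)
  | CFst _ _ _ _ t => fun _ p => CFst (splug t p)
  | CSnd _ _ _ _ t => fun _ p => CSnd (splug t p)
  | CLam _ _ A _ t => fun _ p => CLam (splug t (weaken_plug A p))
  | CApp _ _ _ _ s t => fun _ p => CApp (splug s p) t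
  | Top _ => fun _ _ => Top _
  | LetTop _ _ _ t u => fun _ p => LetTop (splug t p) u
  | Bang _ _ t => fun _ _ => Bang t
  | LetBang _ _ _ _ t u => fun _ p => LetBang (splug t p) u
  | Tens _ _ _ _ t u => fun _ p => Tens t (splug u p)
  | LetTens _ _ _ _ _ s t => fun _ p => LetTens (splug s p) t
  | Abort _ _ A t => fun _ p => Abort A (splug t p)
  | Inl _ _ _ B t => fun _ p => Inl B (splug t p)
  | Inr _ _ A _ t => fun _ p => Inr A (splug t p)
  | Case _ _ _ _ _ s t u => fun _ p => Case (splug s p) t u
  | HLam _ _ _ t => fun _ _ => HLam t
  | HApp _ _ _ _ s t => fun _ p => HApp s (splug t p)
  end.

(* u[t/z] for the stoup variable z of u. *)
Definition ssubst G D (A : cty) B (u : tm G (Some A) B) (t : tm G D A) :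
    tm G D B :=
  @splug G (Some A) B u D t.

Inductive eqtm : forall G D A, tm G D A -> tm G D A -> Prop :=
  | eqtm_refl G D A (t : tm G D A) : eqtm t t
  | eqtm_sym G D A (t u : tm G D A) : eqtm t u -> eqtm u t
  | eqtm_trans G D A (s t u : tm G D A) : eqtm s t -> eqtm t u -> eqtm s u
  | eq_Pair G A B (t t' : tm G None A) (u u' : tm G None B) :
      eqtm t t' -> eqtm u u' -> eqtm (Pair t u) (Pair t' u')
  | eq_Fst G A B (t t' : tm G None (vprod A B)) :
      eqtm t t' -> eqtm (Fst t) (Fst t')
  | eq_Snd G A B (t t' : tm G None (vprod A B)) :
      eqtm t t' -> eqtm (Snd t) (Snd t')
  | eq_Lam G A B (t t' : tm (A :: G) None B) :
      eqtm t t' -> eqtm (Lam t) (Lam t')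
  | eq_App G A B (t t' : tm G None (vfun A B)) (u u' : tm G None A) :
      eqtm t t' -> eqtm u u' -> eqtm (App t u) (App t' u')
  | eq_CPair G D (A B : cty) (t t' : tm G D A) (u u' : tm G D B) :
      eqtm t t' -> eqtm u u' -> eqtm (CPair t u) (CPair t' u')
  | eq_CFst G D (A B : cty) (t t' : tm G D (cwith A B)) :
      eqtm t t' -> eqtm (CFst t) (CFst t')
  | eq_CSnd G D (A B : cty) (t t' : tm G D (cwith A B)) :
      eqtm t t' -> eqtm (CSnd t) (CSnd t')
  | eq_CLam G D A (B : cty) (t t' : tm (A :: G) D B) :
      eqtm t t' -> eqtm (CLam t) (CLam t')
  | eq_CApp G D A (B : cty) (s s' : tm G D (cpow A B)) (t t' : tm G None A) :
      eqtm s s' -> eqtm t t' -> eqtm (CApp s t) (CApp s' t')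
  | eq_LetTop G D (A : cty) (t t' : tm G D cunit) (u u' : tm G None A) :
      eqtm t t' -> eqtm u u' -> eqtm (LetTop t u) (LetTop t' u')
  | eq_Bang G A (t t' : tm G None A) :
      eqtm t t' -> eqtm (Bang t) (Bang t')
  | eq_LetBang G D A (B : cty) (t t' : tm G D (cbang A))
        (u u' : tm (A :: G) None B) :
      eqtm t t' -> eqtm u u' -> eqtm (LetBang t u) (LetBang t' u')
  | eq_Tens G D A (B : cty) (t t' : tm G None A) (u u' : tm G D B) :
      eqtm t t' -> eqtm u u' -> eqtm (Tens t u) (Tens t' u')
  | eq_LetTens G D A (B E : cty) (s s' : tm G D (ctens A B))
        (t t' : tm (A :: G) (Some B) E) :
      eqtm s s' -> eqtm t t' -> eqtm (LetTens s t) (LetTens s' t')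
  | eq_Abort G D (A : cty) (t t' : tm G D czero) :
      eqtm t t' -> eqtm (Abort A t) (Abort A t')
  | eq_Inl G D (A B : cty) (t t' : tm G D A) :
      eqtm t t' -> eqtm (Inl B t) (Inl B t')
  | eq_Inr G D (A B : cty) (t t' : tm G D B) :
      eqtm t t' -> eqtm (Inr A t) (Inr A t')
  | eq_Case G D (A B E : cty) (s s' : tm G D (csum A B))
        (t t' : tm G (Some A) E) (u u' : tm G (Some B) E) :
      eqtm s s' -> eqtm t t' -> eqtm u u' ->
      eqtm (Case s t u) (Case s' t' u')
  | eq_HLam G (A B : cty) (t t' : tm G (Some A) B) :
      eqtm t t' -> eqtm (HLam t) (HLam t')
  | eq_HApp G D (A B : cty) (s s' : tm G None (vlolli A B)) (t t' : tm G D A) :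
      eqtm s s' -> eqtm t t' -> eqtm (HApp s t) (HApp s' t')
  | eta_Star G (t : tm G None vone) : eqtm t (Star G)
  | beta_Fst G A B (t : tm G None A) (u : tm G None B) :
      eqtm (Fst (Pair t u)) t
  | beta_Snd G A B (t : tm G None A) (u : tm G None B) :
      eqtm (Snd (Pair t u)) u
  | eta_Pair G A B (t : tm G None (vprod A B)) :
      eqtm (Pair (Fst t) (Snd t)) t
  | beta_Lam G A B (t : tm (A :: G) None B) (u : tm G None A) :
      eqtm (App (Lam t) u) (vsubst t u)
  | eta_Lam G A B (t : tm G None (vfun A B)) :
      eqtm (Lam (App (weaken A t) (Var (V0 G A)))) t
  | eta_CStar G D (t : tm G D cone) : eqtm t (CStar G D)
  | beta_CFst G D (A B : cty) (t : tm G D A) (u : tm G D B) :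
      eqtm (CFst (CPair t u)) t
  | beta_CSnd G D (A B : cty) (t : tm G D A) (u : tm G D B) :
      eqtm (CSnd (CPair t u)) u
  | eta_CPair G D (A B : cty) (t : tm G D (cwith A B)) :
      eqtm (CPair (CFst t) (CSnd t)) t
  | beta_CLam G D A (B : cty) (t : tm (A :: G) D B) (u : tm G None A) :
      eqtm (CApp (CLam t) u) (vsubst t u)
  | eta_CLam G D A (B : cty) (t : tm G D (cpow A B)) :
      eqtm (CLam (CApp (weaken A t) (Var (V0 G A)))) t
  | beta_Top G (A : cty) (t : tm G None A) : eqtm (LetTop (Top G) t) t
  | eta_Top G D (A : cty) (t : tm G D cunit) (u : tm G (Some cunit) A) :
      eqtm (LetTop t (ssubst u (Top G))) (ssubst u t)
  | beta_Bang G A (B : cty) (t : tm G None A) (u : tm (A :: G) None B) :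
      eqtm (LetBang (Bang t) u) (vsubst u t)
  | eta_Bang G D A (B : cty) (t : tm G D (cbang A))
        (u : tm G (Some (cbang A)) B) :
      eqtm (LetBang t (ssubst (weaken A u) (Bang (Var (V0 G A)))))
           (ssubst u t)
  | beta_Tens G D A (B E : cty) (t : tm G None A) (s : tm G D B)
        (u : tm (A :: G) (Some B) E) :
      eqtm (LetTens (Tens t s) u) (ssubst (vsubst u t) s)
  | eta_Tens G D A (B E : cty) (t : tm G D (ctens A B))
        (u : tm G (Some (ctens A B)) E) :
      eqtm (LetTens t (ssubst (weaken A u)
                              (Tens (Var (V0 G A)) (SVar (A :: G) B))))
           (ssubst u t)
  | eta_Abort G D (A : cty) (t : tm G D czero) (u : tm G (Some czero) A) :
      eqtm (Abort A t) (ssubst u t)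
  | beta_Inl G D (A B E : cty) (t : tm G D A)
        (u : tm G (Some A) E) (u' : tm G (Some B) E) :
      eqtm (Case (Inl B t) u u') (ssubst u t)
  | beta_Inr G D (A B E : cty) (t : tm G D B)
        (u : tm G (Some A) E) (u' : tm G (Some B) E) :
      eqtm (Case (Inr A t) u u') (ssubst u' t)
  | eta_Case G D (A B E : cty) (t : tm G D (csum A B))
        (u : tm G (Some (csum A B)) E) :
      eqtm (Case t (ssubst u (Inl B (SVar G A))) (ssubst u (Inr A (SVar G B))))
           (ssubst u t)
  | beta_HLam G D (A B : cty) (t : tm G (Some A) B) (u : tm G D A) :
      eqtm (HApp (HLam t) u) (ssubst t u)
  | eta_HLam G (A B : cty) (t : tm G None (vlolli A B)) :
      eqtm (HLam (HApp t (SVar G A))) t.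

End Syntax.

Arguments var {V C} G A.
Arguments tm {V C} G D A.
Arguments eqtm {V C} G D A t u.

(* The self-translation relative to R: [vtr] and [tmv] are the bullet
   translations of types and terms, [ctr] and [tmc] the circle ones. *)
Section Translation.
Context {V : Type} {C : eqType} (R : cty V C).
Local Notation vty := (vty V C).
Local Notation cty := (cty V C).
Local Notation ctx := (ctx V C).
Local Notation stoup := (stoup V C).

Fixpoint vtr (A : vty) : vty :=
  match A with
  | vconst a => vconst a
  | vone => vone
  | vprod A B => vprod (vtr A) (vtr B)
  | vfun A B => vfun (vtr A) (vtr B)
  | vcomp A => vlolli (ctr A) R
  | vlolli A B => vlolli (ctr B) (ctr A)
  end
with ctr (A : cty) : cty :=
  match A with
  | cconst a =>
      if R is cconst b then if a == b then cunit else cconst a else cconst a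
  | cone => czero
  | cwith A B => csum (ctr A) (ctr B)
  | cpow A B => ctens (vtr A) (ctr B)
  | cunit => R
  | cbang A => cpow (vtr A) R
  | ctens A B => cpow (vtr A) (ctr B)
  | czero => cone
  | csum A B => cwith (ctr A) (ctr B)
  end.

Definition ctxtr (G : ctx) : ctx := map vtr G.

Fixpoint vartr G A (x : var G A) : var (ctxtr G) (vtr A) :=
  match x in var G A return var (ctxtr G) (vtr A) with
  | V0 G A => V0 (ctxtr G) (vtr A)
  | VS _ _ B y => VS (vtr B) (vartr y)
  end.

(* The judgement translating G | D |- A.  The last case is never reached, as
   with a nonempty stoup the result type is a computation type. *)
Definition jtr (G : ctx) (D : stoup) (A : vty) : Type :=
  match D, A with
  | None, _ => tm (ctxtr G) None (vtr A)
  | Some D, vcomp B => tm (ctxtr G) (Some (ctr B)) (ctr D)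
  | Some _, _ => void
  end.

(* Both translations of terms in a single recursion; in the clauses for the
   rules with an arbitrary stoup, the case [None] is the bullet clause and the
   case [Some _] the circle clause.  The variables k, k_x, k_y, k_z and h of
   the translation always sit in the stoup, so that they are all [SVar] and
   that renamings between them, such as t[k/k_y], are invisible. *)
Fixpoint tmtr G D A (t : tm G D A) : jtr G D A :=
  match t in tm G D A return jtr G D A with
  | Var _ _ x => Var (vartr x)
  | Star G => Star (ctxtr G)
  | Pair _ _ _ t u => Pair (tmtr t) (tmtr u)
  | Fst _ _ _ t => Fst (tmtr t)
  | Snd _ _ _ t => Snd (tmtr t)
  | Lam _ _ _ t => Lam (tmtr t)
  | App _ _ _ t u => App (tmtr t) (tmtr u)
  | SVar G A => SVar (ctxtr G) (ctr A)
  | CStar G D =>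
      match D return jtr G D cone with
      | None => HLam (Abort R (SVar (ctxtr G) czero))
      | Some D => Abort (ctr D) (SVar (ctxtr G) czero)
      end
  | CPair G D A B t u =>
      match D return jtr G D A -> jtr G D B -> jtr G D (cwith A B) with
      | None => fun t u =>
          HLam (Case (SVar (ctxtr G) (csum (ctr A) (ctr B)))
                     (HApp t (SVar _ (ctr A))) (HApp u (SVar _ (ctr B))))
      | Some _ => fun t u =>
          Case (SVar (ctxtr G) (csum (ctr A) (ctr B))) t u
      end (tmtr t) (tmtr u)
  | CFst G D A B t =>
      match D return jtr G D (cwith A B) -> jtr G D A with
      | None => fun t => HLam (HApp t (Inl (ctr B) (SVar _ (ctr A))))
      | Some _ => fun t => ssubst t (Inl (ctr B) (SVar _ (ctr A)))
      end (tmtr t)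
  | CSnd G D A B t =>
      match D return jtr G D (cwith A B) -> jtr G D B with
      | None => fun t => HLam (HApp t (Inr (ctr A) (SVar _ (ctr B))))
      | Some _ => fun t => ssubst t (Inr (ctr A) (SVar _ (ctr B)))
      end (tmtr t)
  | CLam G D A B t =>
      match D return jtr (A :: G) D B -> jtr G D (cpow A B) with
      | None => fun t =>
          HLam (LetTens (SVar (ctxtr G) (ctens (vtr A) (ctr B)))
                        (HApp t (SVar _ (ctr B))))
      | Some _ => fun t =>
          LetTens (SVar (ctxtr G) (ctens (vtr A) (ctr B))) t
      end (tmtr t)
  | CApp G D A B s t =>
      match D return jtr G D (cpow A B) -> jtr G None A -> jtr G D B with
      | None => fun s t => HLam (HApp s (Tens t (SVar _ (ctr B))))
      | Some _ => fun s t => ssubst s (Tens t (SVar _ (ctr B)))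
      end (tmtr s) (tmtr t)
  | Top G => HLam (SVar (ctxtr G) R)
  | LetTop G D A t u =>
      match D return jtr G D cunit -> jtr G None A -> jtr G D A with
      | None => fun t u => HLam (HApp t (HApp u (SVar _ (ctr A))))
      | Some _ => fun t u => ssubst t (HApp u (SVar _ (ctr A)))
      end (tmtr t) (tmtr u)
  | Bang G A t => HLam (CApp (SVar (ctxtr G) (cpow (vtr A) R)) (tmtr t))
  | LetBang G D A B t u =>
      match D return jtr G D (cbang A) -> jtr (A :: G) None B -> jtr G D B with
      | None => fun t u => HLam (HApp t (CLam (HApp u (SVar _ (ctr B)))))
      | Some _ => fun t u => ssubst t (CLam (HApp u (SVar _ (ctr B))))
      end (tmtr t) (tmtr u)
  | Tens G D A B t u =>
      match D return jtr G None A -> jtr G D B -> jtr G D (ctens A B) with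
      | None => fun t u =>
          HLam (HApp u (CApp (SVar _ (cpow (vtr A) (ctr B))) t))
      | Some _ => fun t u =>
          ssubst u (CApp (SVar _ (cpow (vtr A) (ctr B))) t)
      end (tmtr t) (tmtr u)
  | LetTens G D A B E s t =>
      match D return
        jtr G D (ctens A B) -> jtr (A :: G) (Some B) E -> jtr G D E
      with
      | None => fun s t => HLam (HApp s (CLam t))
      | Some _ => fun s t => ssubst s (CLam t)
      end (tmtr s) (tmtr t)
  | Abort G D A t =>
      match D return jtr G D czero -> jtr G D A with
      | None => fun t => HLam (HApp t (CStar _ (Some (ctr A))))
      | Some _ => fun t => ssubst t (CStar _ (Some (ctr A)))
      end (tmtr t)
  | Inl G D A B t =>
      match D return jtr G D A -> jtr G D (csum A B) with
      | None => fun t => HLam (HApp t (CFst (SVar _ (cwith (ctr A) (ctr B)))))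
      | Some _ => fun t => ssubst t (CFst (SVar _ (cwith (ctr A) (ctr B))))
      end (tmtr t)
  | Inr G D A B t =>
      match D return jtr G D B -> jtr G D (csum A B) with
      | None => fun t => HLam (HApp t (CSnd (SVar _ (cwith (ctr A) (ctr B)))))
      | Some _ => fun t => ssubst t (CSnd (SVar _ (cwith (ctr A) (ctr B))))
      end (tmtr t)
  | Case G D A B E s t u =>
      match D return
        jtr G D (csum A B) -> jtr G (Some A) E -> jtr G (Some B) E -> jtr G D E
      with
      | None => fun s t u => HLam (HApp s (CPair t u))
      | Some _ => fun s t u => ssubst s (CPair t u)
      end (tmtr s) (tmtr t) (tmtr u)
  | HLam _ _ _ t => HLam (tmtr t)
  | HApp G D A B s t =>
      match D return jtr G None (vlolli A B) -> jtr G D A -> jtr G D B with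
      | None => fun s t => HLam (HApp t (HApp s (SVar _ (ctr B))))
      | Some _ => fun s t => ssubst t (HApp s (SVar _ (ctr B)))
      end (tmtr s) (tmtr t)
  end.

Definition tmv G A (t : tm G None A) : tm (ctxtr G) None (vtr A) := tmtr t.

Definition tmc G (A B : cty) (t : tm G (Some A) B) :
    tm (ctxtr G) (Some (ctr B)) (ctr A) := tmtr t.

End Translation.

(* Main.v *)
(* A term of computation type A with stoup D amounts, after translation, to a
   linear term [ltr t] in one stoup variable of type A°, with result type D° (or
   R if D is empty).  The formers of &, => and the terminal type become the
   eliminators of their positive duals, and all other term formers act by
   precomposition.  Hence substitution for a context variable commutes strictly
   with the translation, while ltr (u[t/z]) = (ltr t)[ltr u/k] holds up to the
   commuting conversions of the positive types, which follow from their eta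
   laws.  Each axiom for a computation type former then reduces to the axiom of
   the same kind for the dual type former. *)

Require Import Defs.
From mathcomp Require Import all_boot.
From Stdlib Require Import Setoid Morphisms.

Set Implicit Arguments.
Unset Strict Implicit.
Unset Printing Implicit Defensive.

Notation "t ≡ u" := (eqtm _ _ _ t u) (at level 70, no associativity).

#[local] Hint Resolve eqtm_refl : core.

(** * Induction principles, renaming and substitution for context variables *)

Section Substitution.
Context {V C : Type}.
Local Notation vty := (vty V C).
Local Notation cty := (cty V C).
Local Notation ctx := (ctx V C).
Local Notation stoup := (stoup V C).
Implicit Types (G : ctx) (D : stoup).

(** Direct induction is blocked because the stoup and the result type are not variables; the motive
    [Q] is therefore [True] on every other judgement. Induction hypotheses are kept only for the
    subterms that contain the stoup variable, which are those that [splug] traverses. *)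
Lemma stm_ind (P : forall G (F B : cty), tm G (Some F) B -> Prop) :
  (forall G F, P G F F (SVar G F)) ->
  (forall G F, P G F cone (CStar G (Some F))) ->
  (forall G F A B t u, P G F A t -> P G F B u ->
     P G F (cwith A B) (CPair t u)) ->
  (forall G F A B t, P G F (cwith A B) t -> P G F A (CFst t)) ->
  (forall G F A B t, P G F (cwith A B) t -> P G F B (CSnd t)) ->
  (forall G F A B t, P (A :: G) F B t -> P G F (cpow A B) (CLam t)) ->
  (forall G F A B s t, P G F (cpow A B) s -> P G F B (CApp s t)) ->
  (forall G F A t (u : tm G None (vcomp A)), P G F cunit t ->
     P G F A (LetTop t u)) ->
  (forall G F A B t (u : tm (A :: G) None (vcomp B)), P G F (cbang A) t ->
     P G F B (LetBang t u)) ->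
  (forall G F A B (t : tm G None A) u, P G F B u ->
     P G F (ctens A B) (Tens t u)) ->
  (forall G F A B E s (t : tm (A :: G) (Some B) (vcomp E)),
     P G F (ctens A B) s -> P G F E (LetTens s t)) ->
  (forall G F A t, P G F czero t -> P G F A (Abort A t)) ->
  (forall G F A B t, P G F A t -> P G F (csum A B) (Inl B t)) ->
  (forall G F A B t, P G F B t -> P G F (csum A B) (Inr A t)) ->
  (forall G F A B E s (t : tm G (Some A) (vcomp E)) u,
     P G F (csum A B) s -> P G F E (Case s t u)) ->
  (forall G F A B (s : tm G None (vlolli A B)) t, P G F A t ->
     P G F B (HApp s t)) ->
  forall G F B t, P G F B t.
Proof.
move=> pSVar pCStar pCPair pCFst pCSnd pCLam pCApp pLetTop pLetBang pTens
  pLetTens pAbort pInl pInr pCase pHApp G F B t.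
pose Q G D A : tm G D A -> Prop :=
  match D, A with
  | Some F, vcomp B => fun t => P G F B t
  | _, _ => fun _ => True
  end.
suff: Q G (Some F) (vcomp B) t by [].
elim: {G F B} t => //.
- by move=> G [F|].
- by move=> G [F|] A B t IHt u IHu //; apply: pCPair.
- by move=> G [F|] A B t IHt //; apply: pCFst IHt.
- by move=> G [F|] A B t IHt //; apply: pCSnd IHt.
- by move=> G [F|] A B t IHt //; apply: pCLam.
- by move=> G [F|] A B s IHs t IHt //; apply: pCApp IHs.
- by move=> G [F|] A t IHt u IHu //; apply: pLetTop.
- by move=> G [F|] A B t IHt u IHu //; apply: pLetBang IHt.
- by move=> G [F|] A B t IHt u IHu //; apply: pTens.
- by move=> G [F|] A B E s IHs t IHt //; apply: pLetTens IHs.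
- by move=> G [F|] A t IHt //; apply: pAbort.
- by move=> G [F|] A B t IHt //; apply: pInl.
- by move=> G [F|] A B t IHt //; apply: pInr.
- by move=> G [F|] A B E s IHs t IHt u IHu //; apply: pCase IHs.
- by move=> G [F|] A B s IHs t IHt //; apply: pHApp.
Qed.

(** Dependent case analysis at a context of the form [B :: G]: the return clause matches on the
    context and quantifies over [P] inside the branch, so that the index becomes general. *)
Lemma var_ind_cons G B (P : forall A, var (B :: G) A -> Prop) :
  P B (V0 G B) -> (forall A (y : var G A), P A (VS B y)) ->
  forall A x, P A x.
Proof.
move=> p0 pS A x; move: P p0 pS.
refine (match x as x' in var G' A' return
  match G' return var G' A' -> Prop with
  | [::] => fun _ => True
  | B' :: G'' => fun x => forall P : forall A, var (B' :: G'') A -> Prop,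
      P B' (V0 G'' B') -> (forall A (y : var G'' A), P A (VS B' y)) -> P A' x
  end x' with V0 _ _ => _ | VS _ _ _ y => _ end); by move=> P p0 pS.
Qed.

(** The composite is a third renaming that agrees pointwise. Such a hypothesis passes under binders
    by cases on the variable, so no function extensionality is involved; the next composition lemmas
    have the same form. *)
Lemma rename_rename G D A (t : tm G D A) G' G'' (r : renaming G G')
    (r' : renaming G' G'') (r'' : renaming G G'') :
  (forall A x, r' A (r A x) = r'' A x) ->
  rename (rename t r) r' = rename t r''.
Proof.
elim: t G' G'' r r' r'' => {G D A} /=; intros;
  f_equal; auto;
  match goal with H : _ |- _ => apply: H; apply: var_ind_cons => //= ? ?;
    f_equal; auto end.
Qed.

Lemma subst_rename G D A (t : tm G D A) G' G'' (r : renaming G G')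
    (s : substitution G' G'') (s' : substitution G G'') :
  (forall A x, s A (r A x) = s' A x) -> subst (rename t r) s = subst t s'.
Proof.
elim: t G' G'' r s s' => {G D A} /=; intros; auto;
  f_equal; auto;
  match goal with H : _ |- _ => apply: H; apply: var_ind_cons => //= ? ?;
    f_equal; auto end.
Qed.

Lemma rename_weaken G D A (t : tm G D A) G' (r : renaming G G') B :
  rename (weaken B t) (lift_ren r) = weaken B (rename t r).
Proof.
rewrite /weaken (rename_rename t (r'' := fun A x => VS B (r A x))) //.
by rewrite (rename_rename t (r'' := fun A x => VS B (r A x))).
Qed.

Lemma rename_subst G D A (t : tm G D A) G' G'' (s : substitution G G')
    (r : renaming G' G'') (s' : substitution G G'') :
  (forall A x, rename (s A x) r = s' A x) -> rename (subst t s) r = subst t s'.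
Proof.
elim: t G' G'' s r s' => {G D A} /=; intros; auto;
  f_equal; auto;
  match goal with H : _ |- _ => apply: H; apply: var_ind_cons => //= ? ?;
    rewrite rename_weaken; f_equal; auto end.
Qed.

Lemma subst_weaken G D A (t : tm G D A) G' (s : substitution G G') B :
  subst (weaken B t) (lift_sub s) = weaken B (subst t s).
Proof.
rewrite /weaken (subst_rename _ (s' := fun A x => weaken B (s A x))) //.
by rewrite (rename_subst t (s' := fun A x => weaken B (s A x))).
Qed.

Lemma subst_id G D A (t : tm G D A) (s : substitution G G) :
  (forall A x, s A x = Var x) -> subst t s = t.
Proof.
elim: t s => {G D A} /=; intros; auto;
  f_equal; auto;
  match goal with H : _ |- _ => apply: H; apply: var_ind_cons => //= A' y end;
  by match goal with H : forall A x, _ = Var x |- _ => rewrite H end.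
Qed.

Lemma vsubst_V0 G D A B (t : tm (A :: G) D B) :
  vsubst (rename t (lift_ren (fun A' x => VS A x))) (Var (V0 G A)) = t.
Proof.
rewrite /vsubst (subst_rename _ (s' := fun A x => Var x)) ?subst_id //.
by apply: var_ind_cons.
Qed.

(** * Substitution for the stoup variable: unit, naturality and associativity laws *)

Lemma ssubst_SVar G (A B : cty) (t : tm G (Some A) B) :
  ssubst t (SVar G A) = t.
Proof.
rewrite /ssubst; elim/stm_ind: t => //= {G A B};
  by intros; f_equal.
Qed.

Lemma rename_ssubst G D (A B : cty) (t : tm G (Some A) B) (u : tm G D A) G'
    (r : renaming G G') :
  rename (ssubst t u) r = ssubst (rename t r) (rename u r).
Proof.
rewrite /ssubst; elim/stm_ind: t D u G' r => //= {G A B};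
  intros; f_equal => //.
rewrite -rename_weaken; auto.
Qed.

Lemma subst_ssubst G D (A B : cty) (t : tm G (Some A) B) (u : tm G D A) G'
    (s : substitution G G') :
  subst (ssubst t u) s = ssubst (subst t s) (subst u s).
Proof.
rewrite /ssubst; elim/stm_ind: t D u G' s => //= {G A B};
  intros; f_equal => //.
rewrite -subst_weaken; auto.
Qed.

Lemma ssubstA G D (A B E : cty) (t : tm G (Some B) E) (u : tm G (Some A) B)
    (s : tm G D A) :
  ssubst (ssubst t u) s = ssubst t (ssubst u s).
Proof.
rewrite /ssubst; elim/stm_ind: t u s => //= {G B E};
  intros; f_equal => //.
rewrite [RHS]/=/weaken rename_ssubst; auto.
Qed.

#[global] Instance eqtm_Equivalence G D A : Equivalence (@eqtm V C G D A).
Proof.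
split; [exact: eqtm_refl | exact: eqtm_sym | exact: eqtm_trans].
Qed.

(** Equality is assumed compatible with term formers only; a stoup substitution is the beta
    contractum of [HApp (HLam t) u], whose formers are covered. *)
#[global] Instance ssubst_Proper G D A (B : cty) :
  Proper (@eqtm V C _ _ _ ==> @eqtm V C _ _ _ ==> @eqtm V C _ _ _)
    (@ssubst V C G D A B).
Proof.
move=> t t' tt' u u' uu'; rewrite -2!beta_HLam.
by apply: eq_HApp => //; apply: eq_HLam.
Qed.

(** * Commuting conversions of the positive types *)

Lemma ssubst_Abort G (A B : cty) (k : tm G (Some A) B) :
  ssubst k (Abort A (SVar G czero)) ≡ Abort B (SVar G czero).
Proof. by rewrite -[X in X ≡ _]ssubst_SVar; symmetry; apply: eta_Abort. Qed.

(** Seen as a substitution into itself of the stoup variable, the left side is the contractum of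
    [eta_Case]; in the resulting branches, beta selects [t] and [u]. *)
Lemma ssubst_Case G (A B E F : cty) (k : tm G (Some E) F)
    (t : tm G (Some A) E) (u : tm G (Some B) E) :
  ssubst k (Case (SVar G (csum A B)) t u) ≡
  Case (SVar G (csum A B)) (ssubst k t) (ssubst k u).
Proof.
rewrite -[X in X ≡ _]ssubst_SVar -eta_Case !ssubstA.
apply: eq_Case => //; apply: ssubst_Proper => //.
- by rewrite -[X in _ ≡ X]ssubst_SVar; apply: beta_Inl.
- by rewrite -[X in _ ≡ X]ssubst_SVar; apply: beta_Inr.
Qed.

Lemma ssubst_LetTens G A (B E F : cty) (k : tm G (Some E) F)
    (t : tm (A :: G) (Some B) E) :
  ssubst k (LetTens (SVar G (ctens A B)) t) ≡
  LetTens (SVar G (ctens A B)) (ssubst (weaken A k) t).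
Proof.
rewrite -[X in X ≡ _]ssubst_SVar -eta_Tens /weaken rename_ssubst ssubstA.
apply: eq_LetTens => //; apply: ssubst_Proper => //.
(* Reading [t] as its lifted weakening instantiated at the new variable exhibits it as a contractum
   of [beta_Tens]. *)
rewrite -[X in _ ≡ X]ssubst_SVar -[X in _ ≡ ssubst X _]vsubst_V0.
exact: beta_Tens.
Qed.

End Substitution.

(** * Strict compatibility of the translation with renaming and context substitution *)

Section Translation.
Context {V : Type} {C : eqType} (R : cty V C).
Local Notation vty := (vty V C).
Local Notation cty := (cty V C).
Local Notation ctx := (ctx V C).
Local Notation stoup := (stoup V C).
Implicit Types (G : ctx) (D : stoup).

Definition jrename G D A G' (r : renaming (ctxtr R G) (ctxtr R G')) :
    jtr R G D A -> jtr R G' D A :=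
  match D, A return jtr R G D A -> jtr R G' D A with
  | None, _ => fun t => rename t r
  | Some _, vcomp _ => fun t => rename t r
  | Some _, _ => id
  end.

Definition jsubst G D A G' (s : substitution (ctxtr R G) (ctxtr R G')) :
    jtr R G D A -> jtr R G' D A :=
  match D, A return jtr R G D A -> jtr R G' D A with
  | None, _ => fun t => subst t s
  | Some _, vcomp _ => fun t => subst t s
  | Some _, _ => id
  end.

Lemma vartr_lift_ren G G' B (r : renaming G G')
    (r' : renaming (ctxtr R G) (ctxtr R G')) :
  (forall A x, r' _ (vartr R x) = vartr R (r A x)) ->
  forall A (x : var (B :: G) A), lift_ren (B := vtr R B) r' (vartr R x) =
    vartr R (lift_ren (B := B) r x).
Proof. by move=> rr'; apply: var_ind_cons => //= A y; rewrite rr'. Qed.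

(** Relating [r] and [r'] only on translated variables avoids inverting [vartr] to define a renaming
    between translated contexts. Stoup substitutions in the clauses are crossed by
    [rename_ssubst]. *)
Lemma tmtr_rename G D A (t : tm G D A) G' (r : renaming G G')
    (r' : renaming (ctxtr R G) (ctxtr R G')) :
  (forall A x, r' _ (vartr R x) = vartr R (r A x)) ->
  tmtr R (rename t r) = jrename r' (tmtr R t).
Proof.
elim: t G' r r' => {G D A} /=; intros;
  try match goal with D : Defs.stoup _ _ |- _ => destruct D end;
  rewrite /= ?rename_ssubst /=;
  match goal with rr' : forall A x, _ = vartr R _ |- _ =>
    repeat match goal with
    | IH : context [rename ?t _] |- context [tmtr R (rename ?t _)] =>
      first [ rewrite (IH _ _ _ rr')
            | rewrite (IH (_ :: _) _ _ (vartr_lift_ren rr')) ]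
    end; rewrite ?rr' end; done.
Qed.

Lemma tmtr_weaken G D A B (t : tm G D A) :
  tmtr R (weaken B t) =
  jrename (G' := B :: G) (fun A x => VS (vtr R B) x) (tmtr R t).
Proof. exact: tmtr_rename. Qed.

Lemma tmtr_lift_sub G G' B (s : substitution G G')
    (s' : substitution (ctxtr R G) (ctxtr R G')) :
  (forall A x, s' _ (vartr R x) = tmtr R (s A x)) ->
  forall A (x : var (B :: G) A), lift_sub (B := vtr R B) s' (vartr R x) =
    tmtr R (lift_sub (B := B) s x).
Proof.
move=> ss'; apply: var_ind_cons => //= A y.
by rewrite tmtr_weaken -ss'.
Qed.

Lemma tmtr_subst G D A (t : tm G D A) G' (s : substitution G G')
    (s' : substitution (ctxtr R G) (ctxtr R G')) :
  (forall A x, s' _ (vartr R x) = tmtr R (s A x)) ->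
  tmtr R (subst t s) = jsubst s' (tmtr R t).
Proof.
elim: t G' s s' => {G D A} /=; intros;
  try match goal with D : Defs.stoup _ _ |- _ => destruct D end;
  rewrite /= ?subst_ssubst /=;
  match goal with ss' : forall A x, _ = tmtr R _ |- _ =>
    repeat match goal with
    | IH : context [subst ?t _] |- context [tmtr R (subst ?t _)] =>
      first [ rewrite (IH _ _ _ ss')
            | rewrite (IH (_ :: _) _ _ (tmtr_lift_sub ss')) ]
    end; rewrite ?ss' end; done.
Qed.

Definition vsub1 G A (t : tm G None A) : substitution (A :: G) G :=
  @var_case V C (tm G None) G A t (fun A' y => Var y).

Lemma tmtr_vsubst G D A B (t : tm (A :: G) D B) (u : tm G None A) :
  tmtr R (vsubst t u) =
  jsubst (G := A :: G) (G' := G) (vsub1 (tmtr R u)) (tmtr R t).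
Proof. by apply: tmtr_subst; apply: var_ind_cons. Qed.

(* [linear_form] lets both kinds of judgement be treated alike: the bullet
   translation t• : A° -o R is replaced by the body t•{k} with k : A° in the
   stoup. *)
Definition dtr D : cty := if D is Some F then ctr R F else R.

Definition linear_form G D (A : cty) :
    jtr R G D A -> tm (ctxtr R G) (Some (ctr R A)) (dtr D) :=
  match D return jtr R G D A -> tm (ctxtr R G) (Some (ctr R A)) (dtr D) with
  | None => fun t => HApp t (SVar _ (ctr R A))
  | Some _ => id
  end.

Definition ltr G D (A : cty) (t : tm G D A) := linear_form (tmtr R t).

Definition jeq G D A : jtr R G D A -> jtr R G D A -> Prop :=
  match D, A return jtr R G D A -> jtr R G D A -> Prop with
  | None, _ => fun t u => t ≡ u
  | Some _, vcomp _ => fun t u => t ≡ u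
  | Some _, _ => fun _ _ => False
  end.

(** For an empty stoup the two directions are congruence of [HApp] and eta for [HLam]. Equations
    between computation terms can thus be checked on linear forms, whatever the stoup. *)
Lemma jeq_ltr G D (A : cty) (t u : tm G D A) :
  jeq (tmtr R t) (tmtr R u) <-> ltr t ≡ ltr u.
Proof.
case: D t u => [F|] t u //; rewrite /ltr /=; split=> tu.
- exact: eq_HApp.
- by rewrite -[tmtr R t]eta_HLam -[tmtr R u]eta_HLam; apply: eq_HLam.
Qed.

(** * The translation clauses on linear forms, uniform in the stoup *)

Lemma ltr_SVar G A : ltr (SVar G A) = SVar _ (ctr R A).
Proof. by []. Qed.

(** A nonempty stoup gives the circle clause itself. For an empty one, the bullet clause is [HLam]
    of the right side, and applying it to the stoup variable is one beta step. The clauses below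
    hold in the same way. *)
Lemma ltr_CStar G D : ltr (CStar G D) ≡ Abort (dtr D) (SVar _ czero).
Proof. by destruct D; rewrite // /ltr /= beta_HLam ssubst_SVar. Qed.

Lemma ltr_CPair G D (A B : cty) (t : tm G D A) (u : tm G D B) :
  ltr (CPair t u) ≡ Case (SVar _ _) (ltr t) (ltr u).
Proof. by destruct D; rewrite // /ltr /= beta_HLam ssubst_SVar. Qed.

Lemma ltr_CFst G D (A B : cty) (t : tm G D (cwith A B)) :
  ltr (CFst t) ≡ ssubst (ltr t) (Inl (ctr R B) (SVar _ (ctr R A))).
Proof. by destruct D; rewrite // /ltr /= beta_HLam ssubst_SVar. Qed.

Lemma ltr_CSnd G D (A B : cty) (t : tm G D (cwith A B)) :
  ltr (CSnd t) ≡ ssubst (ltr t) (Inr (ctr R A) (SVar _ (ctr R B))).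
Proof. by destruct D; rewrite // /ltr /= beta_HLam ssubst_SVar. Qed.

Lemma ltr_CLam G D A (B : cty) (t : tm (A :: G) D B) :
  ltr (CLam t) ≡ LetTens (SVar (ctxtr R G) (ctens (vtr R A) (ctr R B))) (ltr t).
Proof. by destruct D; rewrite // /ltr /= beta_HLam ssubst_SVar. Qed.

Lemma ltr_CApp G D A (B : cty) (s : tm G D (cpow A B)) (t : tm G None A) :
  ltr (CApp s t) ≡ ssubst (ltr s) (Tens (tmtr R t) (SVar _ (ctr R B))).
Proof. by destruct D; rewrite // /ltr /= beta_HLam ssubst_SVar. Qed.

Lemma ltr_Top G : ltr (Top G) ≡ SVar _ R.
Proof. exact: beta_HLam. Qed.

Lemma ltr_LetTop G D (A : cty) (t : tm G D cunit) (u : tm G None A) :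
  ltr (LetTop t u) ≡ ssubst (ltr t) (ltr u).
Proof. by destruct D; rewrite // /ltr /= beta_HLam ssubst_SVar. Qed.

Lemma ltr_Bang G A (t : tm G None A) :
  ltr (Bang t) ≡ CApp (SVar _ (cpow (vtr R A) R)) (tmtr R t).
Proof. exact: beta_HLam. Qed.

Lemma ltr_LetBang G D A (B : cty) (t : tm G D (cbang A))
    (u : tm (A :: G) None B) :
  ltr (LetBang t u) ≡ ssubst (ltr t) (CLam (ltr u)).
Proof. by destruct D; rewrite // /ltr /= beta_HLam ssubst_SVar. Qed.

Lemma ltr_Tens G D A (B : cty) (t : tm G None A) (u : tm G D B) :
  ltr (Tens t u) ≡
  ssubst (ltr u) (CApp (SVar _ (cpow (vtr R A) (ctr R B))) (tmtr R t)).
Proof. by destruct D; rewrite // /ltr /= beta_HLam ssubst_SVar. Qed.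

Lemma ltr_LetTens G D A (B E : cty) (s : tm G D (ctens A B))
    (t : tm (A :: G) (Some B) E) :
  ltr (LetTens s t) ≡ ssubst (ltr s) (CLam (ltr t)).
Proof. by destruct D; rewrite // /ltr /= beta_HLam ssubst_SVar. Qed.

Lemma ltr_Abort G D (A : cty) (t : tm G D czero) :
  ltr (Abort A t) ≡ ssubst (ltr t) (CStar _ (Some (ctr R A))).
Proof. by destruct D; rewrite // /ltr /= beta_HLam ssubst_SVar. Qed.

Lemma ltr_Inl G D (A B : cty) (t : tm G D A) :
  ltr (Inl B t) ≡ ssubst (ltr t) (CFst (SVar _ (cwith (ctr R A) (ctr R B)))).
Proof. by destruct D; rewrite // /ltr /= beta_HLam ssubst_SVar. Qed.

Lemma ltr_Inr G D (A B : cty) (t : tm G D B) :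
  ltr (Inr A t) ≡ ssubst (ltr t) (CSnd (SVar _ (cwith (ctr R A) (ctr R B)))).
Proof. by destruct D; rewrite // /ltr /= beta_HLam ssubst_SVar. Qed.

Lemma ltr_Case G D (A B E : cty) (s : tm G D (csum A B))
    (t : tm G (Some A) E) (u : tm G (Some B) E) :
  ltr (Case s t u) ≡ ssubst (ltr s) (CPair (ltr t) (ltr u)).
Proof. by destruct D; rewrite // /ltr /= beta_HLam ssubst_SVar. Qed.

Lemma ltr_HApp G D (A B : cty) (s : tm G None (vlolli A B)) (t : tm G D A) :
  ltr (HApp s t) ≡ ssubst (ltr t) (HApp (tmtr R s) (SVar _ (ctr R B))).
Proof. by destruct D; rewrite // /ltr /= beta_HLam ssubst_SVar. Qed.

Lemma ltr_weaken G D A (B : cty) (t : tm G D B) :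
  ltr (weaken A t) = weaken (vtr R A) (ltr t).
Proof. by rewrite /ltr tmtr_weaken; case: D t. Qed.

Lemma ltr_vsubst G D A (B : cty) (t : tm (A :: G) D B) (u : tm G None A) :
  ltr (vsubst t u) = vsubst (A := vtr R A) (ltr t) (tmtr R u).
Proof. by rewrite /ltr tmtr_vsubst; case: D t. Qed.

(** Contravariance reverses the order of substitution. Formers that act by precomposition follow
    from [ssubstA]; for [CStar], [CPair] and [CLam], [ltr u] has to be pushed inside [Abort], [Case]
    and [LetTens] by a commuting conversion. *)
Lemma ltr_ssubst G D (A B : cty) (t : tm G (Some A) B) (u : tm G D A) :
  ltr (ssubst t u) ≡ ssubst (ltr u) (ltr t).
Proof.
move: G A B t D u; apply: (stm_ind (P := fun G A B t => forall D u,
  ltr (ssubst t u) ≡ ssubst (ltr u) (ltr t))).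
- by move=> G F D u; rewrite ltr_SVar ssubst_SVar.
- by move=> G F D u; rewrite (ltr_CStar G D) ltr_CStar ssubst_Abort.
- move=> G F A B t1 t2 IH1 IH2 D u.
  rewrite (ltr_CPair (ssubst t1 u) (ssubst t2 u)).
  by rewrite ltr_CPair ssubst_Case; apply: eq_Case.
- move=> G F A B t IH D u; rewrite (ltr_CFst (ssubst t u)).
  by rewrite ltr_CFst IH ssubstA.
- move=> G F A B t IH D u; rewrite (ltr_CSnd (ssubst t u)).
  by rewrite ltr_CSnd IH ssubstA.
- move=> G F A B t IH D u; rewrite (ltr_CLam (ssubst t (weaken A u))).
  by rewrite ltr_CLam ssubst_LetTens -ltr_weaken; apply: eq_LetTens.
- move=> G F A B s t IH D u; rewrite (ltr_CApp (ssubst s u) t).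
  by rewrite ltr_CApp IH ssubstA.
- move=> G F A t v IH D u; rewrite (ltr_LetTop (ssubst t u) v).
  by rewrite ltr_LetTop IH ssubstA.
- move=> G F A B t v IH D u; rewrite (ltr_LetBang (ssubst t u) v).
  by rewrite ltr_LetBang IH ssubstA.
- move=> G F A B t v IH D u; rewrite (ltr_Tens t (ssubst v u)).
  by rewrite ltr_Tens IH ssubstA.
- move=> G F A B E s t IH D u; rewrite (ltr_LetTens (ssubst s u) t).
  by rewrite (ltr_LetTens s t) IH ssubstA.
- move=> G F A t IH D u; rewrite (ltr_Abort A (ssubst t u)).
  by rewrite ltr_Abort IH ssubstA.
- move=> G F A B t IH D u; rewrite (ltr_Inl B (ssubst t u)).
  by rewrite ltr_Inl IH ssubstA.
- move=> G F A B t IH D u; rewrite (ltr_Inr A (ssubst t u)).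
  by rewrite ltr_Inr IH ssubstA.
- move=> G F A B E s t v IH D u; rewrite (ltr_Case (ssubst s u) t v).
  by rewrite (ltr_Case s t v) IH ssubstA.
- move=> G F A B s t IH D u; rewrite (ltr_HApp s (ssubst t u)).
  by rewrite ltr_HApp IH ssubstA.
Qed.

(** * Soundness of the equational theory under the translation *)

Lemma jeq_refl G D A (t : jtr R G D A) : jeq t t.
Proof. by case: D A t => [F|] // [] //= ? ? []. Qed.

Lemma jeq_sym G D A (t u : jtr R G D A) : jeq t u -> jeq u t.
Proof. by case: D A t u => [F|] [] //= *; apply: eqtm_sym. Qed.

Lemma jeq_trans G D A (s t u : jtr R G D A) : jeq s t -> jeq t u -> jeq s u.
Proof. by case: D A s t u => [F|] [] //= >; apply: eqtm_trans. Qed.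

Lemma eqtm_jeq G D A (t u : tm G D A) : t ≡ u -> jeq (tmtr R t) (tmtr R u).
Proof.
elim=> {G D A t u}.
- by move=> G D A t; apply: jeq_refl.
- by move=> G D A t u _; apply: jeq_sym.
- by move=> G D A s t u _ st _; apply: jeq_trans.
- by move=> G A B t t' u u' _ tt' _ uu'; apply: eq_Pair.
- by move=> G A B t t' _ tt'; apply: eq_Fst tt'.
- by move=> G A B t t' _ tt'; apply: eq_Snd tt'.
- by move=> G A B t t' _ tt'; apply: eq_Lam tt'.
- by move=> G A B t t' u u' _ tt' _ uu'; apply: eq_App tt' uu'.
- move=> G D A B t t' u u' _ /jeq_ltr tt' _ /jeq_ltr uu'; apply/jeq_ltr.
  by rewrite !ltr_CPair; apply: eq_Case.
- move=> G D A B t t' _ /jeq_ltr tt'; apply/jeq_ltr.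
  by rewrite !ltr_CFst tt'.
- move=> G D A B t t' _ /jeq_ltr tt'; apply/jeq_ltr.
  by rewrite !ltr_CSnd tt'.
- move=> G D A B t t' _ /jeq_ltr tt'; apply/jeq_ltr.
  by rewrite !ltr_CLam; apply: eq_LetTens.
- move=> G D A B s s' t t' _ /jeq_ltr ss' _ tt'; apply/jeq_ltr.
  by rewrite !ltr_CApp; apply: ssubst_Proper => //; apply: eq_Tens.
- move=> G D A t t' u u' _ /jeq_ltr tt' _ /jeq_ltr uu'; apply/jeq_ltr.
  by rewrite !ltr_LetTop tt' uu'.
- by move=> G A t t' _ tt'; apply: eq_HLam; apply: eq_CApp.
- move=> G D A B t t' u u' _ /jeq_ltr tt' _ /jeq_ltr uu'; apply/jeq_ltr.
  by rewrite !ltr_LetBang; apply: ssubst_Proper => //; apply: eq_CLam.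
- move=> G D A B t t' u u' _ tt' _ /jeq_ltr uu'; apply/jeq_ltr.
  by rewrite !ltr_Tens; apply: ssubst_Proper => //; apply: eq_CApp.
- move=> G D A B E s s' t t' _ /jeq_ltr ss' _ tt'; apply/jeq_ltr.
  by rewrite 2!ltr_LetTens; apply: ssubst_Proper => //; apply: eq_CLam.
- move=> G D A t t' _ /jeq_ltr tt'; apply/jeq_ltr.
  by rewrite !ltr_Abort tt'.
- move=> G D A B t t' _ /jeq_ltr tt'; apply/jeq_ltr.
  by rewrite !ltr_Inl tt'.
- move=> G D A B t t' _ /jeq_ltr tt'; apply/jeq_ltr.
  by rewrite !ltr_Inr tt'.
- move=> G D A B E s s' t t' u u' _ /jeq_ltr ss' _ tt' _ uu'; apply/jeq_ltr.
  by rewrite 2!ltr_Case; apply: ssubst_Proper => //; apply: eq_CPair.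
- by move=> G A B t t' _ tt'; apply: eq_HLam.
- move=> G D A B s s' t t' _ ss' _ /jeq_ltr tt'; apply/jeq_ltr.
  by rewrite !ltr_HApp; apply: ssubst_Proper => //; apply: eq_HApp.
- by move=> G t; apply: eta_Star.
- by move=> G A B t u; apply: beta_Fst.
- by move=> G A B t u; apply: beta_Snd.
- by move=> G A B t; apply: eta_Pair.
- by move=> G A B t u; rewrite tmtr_vsubst; apply: beta_Lam.
- by move=> G A B t; rewrite /= tmtr_weaken; apply: eta_Lam.
(* Negative formers come first: uniqueness into the terminal type becomes uniqueness out of the
   initial one, the axioms of [cwith] become those of [csum], and those of [cpow] become those of
   [ctens]. *)
- move=> G D t; apply/jeq_ltr; rewrite ltr_CStar eta_Abort.
  by rewrite ssubst_SVar.
- move=> G D A B t u; apply/jeq_ltr; rewrite ltr_CFst ltr_CPair.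
  by rewrite -[X in _ ≡ X]ssubst_SVar; apply: beta_Inl.
- move=> G D A B t u; apply/jeq_ltr; rewrite ltr_CSnd ltr_CPair.
  by rewrite -[X in _ ≡ X]ssubst_SVar; apply: beta_Inr.
- move=> G D A B t; apply/jeq_ltr; rewrite ltr_CPair.
  rewrite -[X in _ ≡ X]ssubst_SVar -eta_Case.
  by apply: eq_Case => //; rewrite ?ltr_CFst ?ltr_CSnd.
- move=> G D A B t u; apply/jeq_ltr; rewrite ltr_CApp ltr_CLam ltr_vsubst.
  by rewrite -[X in _ ≡ X]ssubst_SVar; apply: beta_Tens.
- move=> G D A B t; apply/jeq_ltr; rewrite ltr_CLam.
  rewrite -[X in _ ≡ X]ssubst_SVar -eta_Tens.
  by apply: eq_LetTens => //; rewrite ltr_CApp ltr_weaken.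
(* The linear form of [Top] is the identity on [R], so both unit axioms reduce to the unit laws of
   [ssubst]. *)
- by move=> G A t; apply/jeq_ltr; rewrite ltr_LetTop ltr_Top.
- move=> G D A t u; apply/jeq_ltr.
  by rewrite ltr_LetTop 2!ltr_ssubst ltr_Top.
(* Both [cbang] and [ctens] dualise to [cpow], so their beta and eta axioms come from [beta_CLam]
   and [eta_CLam]. *)
- move=> G A B t u; apply/jeq_ltr.
  rewrite ltr_LetBang ltr_Bang ltr_vsubst; exact: beta_CLam.
- move=> G D A B t u; apply/jeq_ltr; rewrite ltr_LetBang (ltr_ssubst u t).
  apply: ssubst_Proper => //; rewrite -[X in _ ≡ X]eta_CLam.
  by apply: eq_CLam; rewrite ltr_ssubst ltr_Bang ltr_weaken.
- move=> G D A B E t s u; apply/jeq_ltr.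
  rewrite (ltr_LetTens (Tens t s) u) ltr_Tens ltr_ssubst ltr_vsubst ssubstA.
  apply: ssubst_Proper => //; exact: beta_CLam.
- move=> G D A B E t u; apply/jeq_ltr.
  rewrite (ltr_LetTens t) (ltr_ssubst u t).
  apply: ssubst_Proper => //; rewrite -[X in _ ≡ X]eta_CLam.
  by apply: eq_CLam; rewrite ltr_ssubst ltr_Tens ltr_weaken.
(* Dually to the above, [czero] and [csum] use the axioms of [cone] and [cwith]. *)
- move=> G D A t u; apply/jeq_ltr; rewrite ltr_Abort ltr_ssubst.
  by apply: ssubst_Proper => //; apply/eqtm_sym/eta_CStar.
- move=> G D A B E t u u'; apply/jeq_ltr.
  rewrite (ltr_Case (Inl B t)) ltr_Inl ltr_ssubst ssubstA.
  by apply: ssubst_Proper => //; apply: beta_CFst.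
- move=> G D A B E t u u'; apply/jeq_ltr.
  rewrite (ltr_Case (Inr A t)) ltr_Inr ltr_ssubst ssubstA.
  by apply: ssubst_Proper => //; apply: beta_CSnd.
- move=> G D A B E t u; apply/jeq_ltr; rewrite (ltr_Case t) (ltr_ssubst u t).
  apply: ssubst_Proper => //; rewrite -[X in _ ≡ X]eta_CPair.
  by apply: eq_CPair; rewrite ltr_ssubst ?ltr_Inl ?ltr_Inr.
(* The linear function type is self-dual: its axioms translate to themselves. *)
- move=> G D A B t u; apply/jeq_ltr; rewrite ltr_HApp ltr_ssubst.
  apply: ssubst_Proper => //; rewrite -[X in _ ≡ X]ssubst_SVar.
  exact: beta_HLam.
- move=> G A B t; rewrite /= -[X in _ ≡ X]eta_HLam.
  exact: eq_HLam.
Qed.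

End Translation.

Theorem theorem5p2 (V : Type) (C : eqType) (R : cty V C) :
  (forall (G : ctx V C) (A : vty V C) (t u : tm G None A),
     eqtm G None A t u ->
     eqtm (ctxtr R G) None (vtr R A) (tmv R t) (tmv R u)) /\
  (forall (G : ctx V C) (A B : cty V C) (t u : tm G (Some A) (vcomp B)),
     eqtm G (Some A) (vcomp B) t u ->
     eqtm (ctxtr R G) (Some (ctr R B)) (vcomp (ctr R A)) (tmc R t) (tmc R u)).
(* At each of the two forms of judgement, [jeq] unfolds to [eqtm]. *)
Proof. by split=> G A => [|B] t u /(eqtm_jeq R). Qed.
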